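(* Let $X$ be a median pretree whose shadow topology is Polish, let $c\le d$ be real numbers and $r>0$. Then every sequence $\{f_n\colon X\to[c,d]\}_{n\in\mathbb{N}}$ of functions with $\Upsilon(f_n)\le r$ for all $n$ has a pointwise convergent subsequence, which converges to a function $f\colon X\to[c,d]$ with $\Upsilon(f)\le r$.
   Context: Pretree: a pair $(X,R)$ with $X$ a set and $R$ a ternary relation on $X$ (write $\langle a,b,c\rangle$ for $(a,b,c)\in R$) such that for all $a,b,c,d\in X$: (B1) $\langle a,b,c\rangle\Rightarrow\langle c,b,a\rangle$; (B2) $\langle a,b,c\rangle\wedge\langle a,c,b\rangle\Leftrightarrow b=c$; (B3) $\langle a,b,c\rangle\Rightarrow\langle a,b,d\rangle\vee\langle d,b,c\rangle$. Intervals: $[u,v]:=\{x\in X:\langle u,x,v\rangle\}$ for $u,v\in X$. Median pretree: a pretree such that $[a,b]\cap[a,c]\cap[b,c]$ is nonempty for all $a,b,c\in X$; this intersection is then a singleton, whose element is denoted $m(a,b,c)$. A subset $Y\subseteq X$ is a subalgebra if $m(a,b,c)\in Y$ for all $a,b,c\in Y$. Shadow topology on a pretree $X$: the topology having as a subbase of open sets all branches $\{x\in X: u\notin[x,v]\}$, where $u,v\in X$, $u\neq v$. A topological space is Polish if it is homeomorphic to a separable complete metric space. Adjacent doublets: for $Y\subseteq X$, $adj(Y)$ is the set of all two-element subsets $\{a,b\}\subseteq Y$ with $[a,b]\cap Y=\{a,b\}$. Variation: for a bounded function $f\colon X\to\mathbb{R}$ and a finite subalgebra $\sigma\subseteq X$,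 put $\Upsilon(f,\sigma):=\sum_{\{a,b\}\in adj(\sigma)}|f(a)-f(b)|$, and $\Upsilon(f):=\sup\{\Upsilon(f,\sigma):\sigma \text{ a finite subalgebra of } X\}$. *)

(* Defs.v *)
From HB Require Import structures.
From mathcomp Require Import all_boot all_order all_algebra.
From mathcomp Require Import all_classical all_reals all_analysis.

Set Implicit Arguments.
Unset Strict Implicit.
Unset Printing Implicit Defensive.

Import Order.TTheory GRing.Theory Num.Theory.
Import numFieldNormedType.Exports.

Local Open Scope classical_set_scope.
Local Open Scope ring_scope.

Section Pretree.
Variables (X : choiceType) (B : X -> X -> X -> Prop).

Record pretree : Prop := Pretree {
  pretree_sym : forall a b c, B a b c -> B c b a;
  pretree_anti : forall a b c, B a b c /\ B a c b <-> b = c;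
  pretree_split : forall a b c d, B a b c -> B a b d \/ B d b c }.

Definition ival (u v : X) : set X := [set x | B u x v].

Definition medians (a b c : X) : set X :=
  ival a b `&` ival a c `&` ival b c.

Record median_pretree : Prop := MedianPretree {
  median_is_pretree : pretree;
  medians_neq0 : forall a b c, medians a b c !=set0 }.

(* The default value [a] is irrelevant in a median pretree, see [medianP]. *)
Definition median (a b c : X) : X := xget a (medians a b c).

Lemma medians_unique (a b c x y : X) :
  pretree -> medians a b c x -> medians a b c y -> x = y.
Proof.
move=> [Bsym Banti Bsplit] [[xab xac] xbc] [[yab yac] ybc].
have key p : B p x y -> B p y x -> x = y by move=> h k; apply/(Banti p).
have P u v z w : B u z v -> B u z w \/ B v z w.
  by move=> /(Bsplit _ _ _ w) [h|/Bsym h]; [left|right].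
have [h1|h1] := P _ _ _ y xab; have [h2|h2] := P _ _ _ y xac;
have [h3|h3] := P _ _ _ y xbc; have [k1|k1] := P _ _ _ x yab;
have [k2|k2] := P _ _ _ x yac; have [k3|k3] := P _ _ _ x ybc;
by eauto 3 using key.
Qed.

Lemma medianP (a b c : X) :
  median_pretree -> medians a b c = [set median a b c].
Proof.
move=> [pX mX]; have mabc : medians a b c (median a b c) by rewrite /median; apply: xgetPex; exact: mX.
apply/seteqP; split=> [x xabc|x ->//].
exact: medians_unique pX xabc mabc.
Qed.

Definition subalgebra (Y : set X) : Prop :=
  forall a b c, Y a -> Y b -> Y c -> Y (median a b c).

Definition adj (Y : set X) : set (set X) :=
  [set D | exists a b,
    [/\ a <> b, Y a, Y b, ival a b `&` Y = [set a; b] & D = [set a; b]]].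

Definition branch (u v : X) : set X := [set x | ~ ival x v u].

Definition branches : set (set X) :=
  [set A | exists u v, u <> v /\ A = branch u v].

End Pretree.

(* [X] with the topology that has [branches B] as a subbase of open sets *)
Definition shadow (X : choiceType) (B : X -> X -> X -> Prop) : Type := X.

HB.instance Definition _ (X : choiceType) (B : X -> X -> X -> Prop) :=
  Choice.on (shadow B).
HB.instance Definition _ (X : choiceType) (B : X -> X -> X -> Prop) :=
  isSubBaseTopological.Build (shadow B) (branches B) id.

Definition separable (T : topologicalType) : Prop :=
  exists2 D : set T, countable D & dense D.

(* The library's [completeType] is pointed, which would exclude the empty
   space. *)
Definition complete_metric (R : realType) (M : metricType R) : Prop :=
  forall u : nat -> M, cauchy (u @ \oo) -> exists x : M, u @ \oo --> x.

Definition homeomorphic (S T : topologicalType) : Prop :=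
  exists (f : S -> T) (g : T -> S),
    [/\ continuous f, continuous g, cancel f g & cancel g f].

Definition polish (R : realType) (T : topologicalType) : Prop :=
  exists M : metricType R,
    [/\ separable M, complete_metric M & homeomorphic T M].

Section Variation.
Variables (R : realType) (X : choiceType) (B : X -> X -> X -> Prop).

(* The value |f a - f b| at an unordered pair D = {a, b} *)
Definition jump (f : X -> R) (D : set X) : R :=
  xget 0 [set t | exists a b, D = [set a; b] /\ t = `|f a - f b|].

Lemma jumpE (f : X -> R) (a b : X) : jump f [set a; b] = `|f a - f b|.
Proof.
rewrite /jump; case: xgetP => [t -> [x [y [abE ->]]]|/(_ `|f a - f b|)]; last first.
  by case; exists a, b.
have [ax bx] : [set x; y] a /\ [set x; y] b.
  by rewrite -abE; split; [left|right].
have [xa ya] : [set a; b] x /\ [set a; b] y.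
  by rewrite abE; split; [left|right].
move: ax bx xa ya => /= [->|->] [->|->] [e|e] [e'|e'] //;
by rewrite -?e -?e' ?subrr // distrC.
Qed.

Definition tree_variation_on (f : X -> R) (s : set X) : R :=
  \sum_(D \in adj B s) jump f D.

Definition tree_variation (f : X -> R) : \bar R :=
  ereal_sup [set (tree_variation_on f s)%:E |
             s in [set s : set X | finite_set s /\ subalgebra B s]].

End Variation.

(* Main.v *)
Require Import Defs.
From HB Require Import structures.
From mathcomp Require Import all_boot all_order all_algebra.
From mathcomp Require Import all_classical all_reals all_analysis.
From mathcomp Require Import finmap.
Import Order.TTheory GRing.Theory Num.Theory.
Import numFieldNormedType.Exports.
Local Open Scope classical_set_scope.
Local Open Scope ring_scope.

Set Implicit Arguments.
Unset Strict Implicit.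
Unset Printing Implicit Defensive.

(** Disjoint convex sets contribute additively to the variation, and distinct
points are separated by disjoint branches, which are convex and open. As the
shadow topology is second countable, it has a countable network [V]. Pass to a
subsequence along which, for every [i] and [k], the statement "[f n] oscillates
by at most [1 / (k + 1)] on [V i]" is eventually constant. For each [k], only
finitely many points have no [V i] around them on which the oscillation
eventually is that small: any [N] of these points have disjoint convex
neighbourhoods, each contributing more than [1 / (k + 1)] to a total of at most
[r]. Hence a further subsequence converges at these countably many exceptional
points and at one point of each [V i]; at any other point it is then Cauchy. *)

(** * Betweenness, convexity and branches in a pretree *)

Section Pretrees.
Variables (X : choiceType) (B : X -> X -> X -> Prop).

Definition tree_convex (C : set X) : Prop :=
  forall x y, C x -> C y -> ival B x y `<=` C.

Lemma tree_convexI (C D : set X) :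
  tree_convex C -> tree_convex D -> tree_convex (C `&` D).
Proof.
move=> cC cD x y [Cx Dx] [Cy Dy] z xzy.
by split; [exact: cC Cx Cy _ xzy|exact: cD Dx Dy _ xzy].
Qed.

Hypothesis pB : pretree B.

Lemma betw_sym {a b c} : B a b c -> B c b a.
Proof. by case: pB => s _ _; exact: s. Qed.

Lemma betw_antisym {a b c} : B a b c -> B a c b -> b = c.
Proof. by case: pB => _ s _ ? ?; exact/(s a). Qed.

Lemma betw_split {a b c} d : B a b c -> B a b d \/ B d b c.
Proof. by case: pB => _ _ s; exact: s. Qed.

Lemma betwr a b : B a b b.
Proof. by case: pB => _ s _; have [_ /(_ erefl)[]] := s a b b. Qed.

Lemma betwl a b : B a a b. Proof. exact/betw_sym/betwr. Qed.

Lemma betw_refl_eq {a b} : B a b a -> b = a.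
Proof. by move=> h; exact: betw_antisym h (betwl _ _). Qed.

(** Were [t] outside [[x, y]], splitting at [y] and then at [t] would force [t = z], a point of
    [[x, y]]. *)
Lemma betw_trans {x y z t} : B x z y -> B x t z -> B x t y.
Proof.
move=> xzy xtz; have [//|ytz] := betw_split y xtz.
have [xzt|tzy] := betw_split t xzy.
  by rewrite (betw_antisym xtz xzt).
by rewrite (betw_antisym ytz (betw_sym tzy)).
Qed.

Lemma convex_ival u v : tree_convex (ival B u v).
Proof.
move=> x y ux uy z xzy; rewrite /ival/= in ux uy *.
have [xzu|uzy] := betw_split u xzy; last exact: betw_trans uy uzy.
exact: betw_trans ux (betw_sym xzu).
Qed.

Lemma sub_ivall {x y z} : B x z y -> ival B x z `<=` ival B x y.
Proof. by move=> xzy; apply: convex_ival => //; exact: betwl. Qed.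

Lemma sub_ivalr {x y z} : B x z y -> ival B z y `<=` ival B x y.
Proof. by move=> xzy; apply: convex_ival => //; exact: betwr. Qed.

Lemma ivalI_eq {x y z t} : B x z y -> B x t z -> B z t y -> t = z.
Proof.
move=> xzy xtz zty; have [xzt|tzy] := betw_split t xzy.
  exact: betw_antisym xtz xzt.
by apply: (@betw_antisym y); exact: betw_sym.
Qed.

Lemma branch_refl {u v} : u <> v -> branch B u v v.
Proof. by move=> uv /betw_refl_eq. Qed.

Lemma branch_betw {u v x y} : branch B u v x -> branch B u v y -> ~ B x u y.
Proof. by move=> xv yv /(betw_split v)[//|/betw_sym]. Qed.

(** If [z] in [[x, y]] is outside the branch, then [u] lies between [z] and each of [x], [y]. This
    forces [z = u], although [u] is never between two points of the branch. *)
Lemma convex_branch u v : tree_convex (branch B u v).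
Proof.
move=> x y xv yv z xzy zuv; have nxy := branch_betw xv yv.
have zux : B z u x by have [//|] := betw_split x zuv.
have zuy : B z u y by have [//|] := betw_split y zuv.
have [xzu|uzy] := betw_split u xzy.
  by apply: nxy; rewrite -(betw_antisym xzu (betw_sym zux)).
by apply: nxy; rewrite -(betw_antisym (betw_sym uzy) (betw_sym zuy)).
Qed.

End Pretrees.

(** * Medians, finite subalgebras and separation by branches *)

Section MedianPretrees.
Variables (X : choiceType) (B : X -> X -> X -> Prop).
Hypothesis mB : median_pretree B.
Let pB := median_is_pretree mB.

Lemma mediansP a b c : medians B a b c (median B a b c).
Proof. by rewrite (medianP a b c mB). Qed.

Lemma medians_eq {a b c m} : medians B a b c m -> median B a b c = m.
Proof. by rewrite (medianP a b c mB) => ->. Qed.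

(** If [u] lay in both [[a, m]] and [[b, m]], then [m] in [[a, b]] would give [m = u]. So the branch
    at [u] containing a median contains one of its arguments. *)
Lemma median_branch {a b c u} : median B a b c <> u ->
  ~ B a u (median B a b c) \/ ~ B b u (median B a b c).
Proof.
set m := median B a b c => mu; apply/not_andP => -[aum bum].
have [[amb _] _] : medians B a b c m := mediansP _ _ _.
have [amu|umb] := betw_split pB u amb.
  exact/mu/(betw_antisym pB amu aum).
exact/mu/(betw_antisym pB (betw_sym pB umb) bum).
Qed.

Lemma betw_change {a p b u} : ~ B a u p -> B p u b -> B a u b.
Proof. by move=> naup /(betw_split pB a)[/(betw_sym pB)|]. Qed.

(** The subalgebra generated by [F]: a single round of medians is already closed. *)
Definition medians_of (F : set X) : set X :=
  (fun p => median B p.1.1 p.1.2 p.2) @` (F `*` F `*` F).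

Lemma medians_of_sub F : F `<=` medians_of F.
Proof.
move=> x Fx; exists (x, x, x) => //=; apply: medians_eq.
by split; [split|]; exact: (betwl pB).
Qed.

Lemma finite_medians_of F : finite_set F -> finite_set (medians_of F).
Proof. by move=> fF; apply/finite_image/finite_setX => //; exact: finite_setX. Qed.

(* If [t = median p q s] differs from [p], [q] and [s], these lie in three
   different branches at [t], and each of these branches meets [F]. *)
Lemma subalgebra_medians_of F : subalgebra B (medians_of F).
Proof.
move=> p q s Sp Sq Ss; set t := median B p q s.
have [->//|/eqP pt] := eqVneq t p; have [->//|/eqP qt] := eqVneq t q.
have [->//|/eqP st] := eqVneq t s.
have rep z : t <> z -> medians_of F z -> exists2 a, F a & ~ B a t z.
  move=> tz [[[a b] c]]/= [[Fa Fb] Fc] abcz; subst z.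
  by have [|h] := @median_branch a b c t (nesym tz); [exists a|exists b].
have [a Fa ap] := rep _ pt Sp; have [b Fb bq] := rep _ qt Sq.
have [c Fc cs] := rep _ st Ss.
have [[ptq pts] qts] : medians B p q s t := mediansP _ _ _.
exists (a, b, c) => //=; apply: medians_eq.
have R := betw_sym pB; split; [split|].
- exact: betw_change ap (R _ _ _ (betw_change bq (R _ _ _ ptq))).
- exact: betw_change ap (R _ _ _ (betw_change cs (R _ _ _ pts))).
- exact: betw_change bq (R _ _ _ (betw_change cs (R _ _ _ qts))).
Qed.

(** If some [z] is strictly between, two branches at [z] do. Otherwise take the branch at [y]
    towards [x] and the one at [x] towards [y]: for a common point [t], the median of [x], [y], [t]
    would be strictly between [x] and [y]. *)
Lemma branch_separation x y : x <> y -> exists p : set X * set X,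
  [/\ branches B p.1, branches B p.2, p.1 x, p.2 y & p.1 `&` p.2 = set0].
Proof.
move=> xy.
have [[z [xzy zx zy]]|nz] := pselect (exists z, [/\ B x z y, z <> x & z <> y]).
  exists (branch B z x, branch B z y); split => /=.
  - by exists z, x.
  - by exists z, y.
  - exact: (branch_refl pB).
  - exact: (branch_refl pB).
  - apply/seteqP; split=> // t [/= tx ty]; apply: tx.
    by have [/(betw_sym pB)//|/ty] := betw_split pB t xzy.
exists (branch B y x, branch B x y); split => /=.
- by exists y, x; split=> // /esym.
- by exists x, y.
- by apply: (branch_refl pB) => // /esym.
- exact: (branch_refl pB).
- apply/seteqP; split=> // t [/= tyx txy].
  have [[xmy xmt] ymt] := mediansP x y t.
  apply: nz; exists (median B x y t); split => // e.
    by apply: txy; apply: (betw_sym pB); move: ymt; rewrite e.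
  by apply: tyx; apply: (betw_sym pB); move: xmt; rewrite e.
Qed.

End MedianPretrees.

(** * Variation over disjoint convex sets *)

Section Variation.
Variables (R : realType) (X : choiceType) (B : X -> X -> X -> Prop).
Implicit Types (f : X -> R) (s : set X).

Lemma jump_ge0 f D : 0 <= jump f D.
Proof. by rewrite /jump; case: xgetP => // t -> [a [b [_ ->]]]. Qed.

Lemma finite_adj s : finite_set s -> finite_set (adj B s).
Proof.
move=> fs; apply: (@sub_finite_set _ _
  ((fun p => [set p.1; p.2]) @` (s `*` s))).
  by move=> D [a [b [_ sa sb _ ->]]]; exists (a, b).
by apply/finite_image/finite_setX.
Qed.

Lemma tree_variation_onE f s : finite_set s ->
  tree_variation_on B f s = \sum_(D <- fset_set (adj B s)) jump f D.
Proof. by move=> fs; rewrite /tree_variation_on fsbig_finite//; exact: finite_adj. Qed.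

Lemma tree_variationP f (r : R) : (tree_variation B f <= r%:E)%E <->
  forall s, finite_set s -> subalgebra B s -> tree_variation_on B f s <= r.
Proof.
split=> [h s fs ss|h].
  by rewrite -lee_fin; apply: le_trans h; apply: ereal_sup_ubound; exists s.
by apply: ge_ereal_sup => _ [s [fs ss] <-]; rewrite lee_fin; exact: h.
Qed.

Hypothesis pB : pretree B.

(** Induction on the number of points of [s] in [[x, y]]. A point [z] of [s] strictly between cuts
    the interval into halves that share only [z], hence share no doublet; if there is none, [{x, y}]
    is itself a doublet. *)
Lemma dist_le_jumps f s x y : finite_set s -> s x -> s y ->
  `|f x - f y| <=
  \sum_(D <- fset_set (adj B s) | `[< D `<=` ival B x y >]) jump f D.
Proof.
move=> fs; have [n] := ubnP #|` fset_set (ival B x y `&` s)|.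
elim: n x y => // n IH x y; rewrite ltnS => sz sx sy.
have [<-|/eqP xy] := eqVneq x y.
  by rewrite subrr normr0 sumr_ge0// => D _; exact: jump_ge0.
have fI u v : finite_set (ival B u v `&` s) by apply: sub_finite_set fs => ? [].
have [[z [xzy sz' zx zy]]|nz] :=
  pselect (exists z, [/\ B x z y, s z, z <> x & z <> y]).
  (* Each half misses an endpoint [w] of [[x, y]], so it has fewer points of [s]. *)
  have card_lt u v w : ival B u v `<=` ival B x y -> B x w y -> s w ->
      ~ B u w v -> (#|` fset_set (ival B u v `&` s)| < n)%N.
    move=> uv xwy sw nuwv; apply: leq_trans sz; apply: fproper_ltn_card.
    rewrite fproperEneq; apply/andP; split; last first.
      by rewrite -fset_set_sub//; apply: setSI.
    apply/eqP => /(congr1 (fun A : {fset X} => w \in A)).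
    rewrite !in_fset_set// => e; apply: nuwv.
    suff /set_mem[] : w \in ival B u v `&` s by [].
    by rewrite e; exact: mem_set.
  have xz : ~ B x y z by move=> h; apply: zy; exact: (betw_antisym pB xzy h).
  have yz : ~ B z x y.
    move=> h; apply: zx; apply: (betw_antisym pB (betw_sym pB xzy)).
    exact: (betw_sym pB).
  have := IH x z (card_lt _ _ _ (sub_ivall pB xzy) (betwr pB _ _) sy xz) sx sz'.
  have := IH z y (card_lt _ _ _ (sub_ivalr pB xzy) (betwl pB _ _) sx yz) sz' sy.
  move=> le_zy le_xz; apply: (le_trans (ler_distD (f z) _ _)).
  apply: (le_trans (lerD le_xz le_zy)).
  rewrite big_mkcond [X in _ + X]big_mkcond -big_split [leRHS]big_mkcond/=.
  rewrite big_seq [leRHS]big_seq.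
  apply: ler_sum => D; rewrite in_fset_set; last exact: finite_adj.
  move=> /set_mem[a [b [ab _ _ _ ->]]].
  have disj : [set a; b] `<=` ival B x z -> ~ [set a; b] `<=` ival B z y.
    move=> xz' zy'; apply: ab; have eqz t : [set a; b] t -> t = z.
      by move=> Dt; exact: (ivalI_eq pB xzy (xz' t Dt) (zy' t Dt)).
    by rewrite (eqz a (or_introl erefl)) (eqz b (or_intror erefl)).
  have J := jump_ge0 f [set a; b].
  case: asboolP => h1; case: asboolP => h2; case: asboolP => h3;
    rewrite ?addr0 ?add0r//; try by case: (disj h1 h2).
  - by exfalso; apply: h3 => t /h1; exact: (sub_ivall pB).
  - by exfalso; apply: h3 => t /h2; exact: (sub_ivalr pB).
have axy : adj B s [set x; y].
  exists x, y; split => //; apply/seteqP; split => [z [xzy sz']|z [] ->].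
    have [->|/eqP zx] := eqVneq z x; first by left.
    have [->|/eqP zy] := eqVneq z y; first by right.
    by exfalso; apply: nz; exists z.
    by split=> //; exact: (betwl pB).
  by split=> //; exact: (betwr pB).
rewrite (big_rem [set x; y])/=; last first.
  by rewrite in_fset_set; [exact: mem_set|exact: finite_adj].
rewrite asboolT; last by move=> z [] ->; [exact: (betwl pB)|exact: (betwr pB)].
rewrite jumpE lerDl sumr_ge0// => D _; exact: jump_ge0.
Qed.

End Variation.

(** One finite subalgebra contains all the [x i] and [y i]. Each distance is at most the sum of the
    jumps over doublets inside [C i], and disjointness charges every doublet to at most one [i]. *)
Lemma sum_dist_le_variation (R : realType) (X : choiceType) (B : X -> X -> X -> Prop)
    (f : X -> R) (r : R) (I : finType) (C : I -> set X) (x y : I -> X) :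
  median_pretree B -> (tree_variation B f <= r%:E)%E ->
  (forall i, tree_convex B (C i)) ->
  (forall i j, i != j -> C i `&` C j = set0) ->
  (forall i, C i (x i)) -> (forall i, C i (y i)) ->
  \sum_i `|f (x i) - f (y i)| <= r.
Proof.
move=> mB /tree_variationP fr cC dC Cx Cy.
pose F := range x `|` range y.
have fF : finite_set F by rewrite finite_setU; split; exact: finite_image.
have fs := finite_medians_of B fF; set s := medians_of B F in fs.
have FS := medians_of_sub mB (F := F).
apply: le_trans (fr s fs (@subalgebra_medians_of _ _ mB F)).
rewrite tree_variation_onE//; set E := fset_set _.
have step i : `|f (x i) - f (y i)| <=
    \sum_(D <- E | `[< D `<=` C i >]) jump f D.
  have sx : s (x i) by apply: FS; left; exists i.
  have sy : s (y i) by apply: FS; right; exists i.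
  apply: (le_trans (dist_le_jumps (median_is_pretree mB) f fs sx sy)).
  rewrite big_mkcond [leRHS]big_mkcond/=; apply: ler_sum => D _.
  case: asboolP => h; case: asboolP => h' //; last exact: jump_ge0.
  by exfalso; apply: h' => t /h; exact: cC.
apply: (le_trans (ler_sum _ (fun i _ => step i))).
rewrite (exchange_big_dep xpredT)//= big_seq [leRHS]big_seq.
apply: ler_sum => D; rewrite in_fset_set; last exact: finite_adj.
move=> /set_mem[a [b [ab _ _ _ Dab]]].
have [[i Di]|nD] := pselect (exists i, D `<=` C i).
  rewrite (big_pred1 i)// => j; apply/asboolP/eqP => [Dj|-> //].
  apply/eqP/negPn/negP => ji; suff : (C j `&` C i) a by rewrite dC.
  by split; [apply: Dj|apply: Di]; rewrite Dab; left.
rewrite big_pred0 ?jump_ge0// => j; apply/asboolP => Dj; apply: nD; by exists j.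
Qed.

(** * Countable networks from separable metric spaces *)

Definition network (T : topologicalType) (I : Type) (V : I -> set T) : Prop :=
  forall x W, nbhs x W -> exists2 i, V i x & V i `<=` W.

Lemma separable_network (R : realType) (M : metricType R) : separable M ->
  exists V : nat * nat -> set M, network V.
Proof.
move=> [D /countable_injP[h hD] dD].
(* The index [(m, n)] stands for the ball of radius [1 / (n + 1)] about the point of [D] numbered
   [m] by [h]; the set is empty if there is none. *)
exists (fun p => [set y | exists2 a, D a /\ h a = p.1 & ball a p.2.+1%:R^-1 y]).
move=> x W /nbhs_ballP[e /= e0 xeW].
have e20 : 0 < e / 2 by rewrite divr_gt0.
have [n _ /(_ n (leqnn n))/= ne] := near_infty_natSinv_lt (PosNum e20).
have n0 : (0 : R) < n.+1%:R^-1 by rewrite invr_gt0.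
have nb : nbhs x (ball x n.+1%:R^-1) by apply/nbhs_ballP; exists n.+1%:R^-1.
have [a [/interior_subset xa Da]] :=
  dD _ (ex_intro _ x (nbhs_singleton (nbhs_interior nb))) (@open_interior _ _).
exists (h a, n) => /=; first by exists a => //; exact: ball_sym.
move=> y [b [Db hba] bny]; have {hba}ba : b = a.
  by apply: hD; [exact: mem_set|exact: mem_set|exact: hba].
rewrite {}ba in bny; apply: xeW.
(* Both [x] and [y] are within [1 / (n + 1) < e / 2] of the same centre [a]. *)
apply: (@le_ball _ _ _ (n.+1%:R^-1 + n.+1%:R^-1)); last exact: ball_triangle bny.
by rewrite (splitr e) lerD// ltW.
Qed.

Lemma homeomorphic_network (S T : topologicalType) (I : Type) (V : I -> set T) :
  homeomorphic S T -> network V -> exists U : I -> set S, network U.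
Proof.
move=> [f [g [_ cg fK _]]] nV; exists (fun i => f @^-1` V i) => x W xW.
have [i Vi VW] : exists2 i, V i (f x) & V i `<=` g @^-1` W.
  by apply: nV; apply: cg; rewrite fK.
by exists i => // y /VW; rewrite /preimage/= fK.
Qed.

(** * Extraction of subsequences *)

Lemma diagonal_subsequence (R : realType) (c d : R) (F : nat -> nat -> R) :
  (forall n m, c <= F n m <= d) ->
  exists2 phi : nat -> nat, increasing_seq phi &
    forall m, cvgn (fun n => F (phi n) m).
Proof.
(* By Tychonoff the rows [F n] have a cluster point [z] in the compact product of copies of
   [[c, d]]. The subsequence has its [k]-th row within [1 / (k + 1)] of [z] in the first [k]
   coordinates. *)
move=> Fcd; pose P := prod_topology (fun _ : nat => (R : topologicalType)).
pose K : set P := [set y : P | forall m, `[c, d]%classic (y m)].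
have cK : compact K.
  apply: (@tychonoff nat (fun=> R) (fun=> `[c, d]%classic)) => m.
  exact: segment_compact.
have FK : ((F : nat -> P) @ \oo) K.
  by exists 0%N => // n _ m; rewrite /= in_itv/=; exact: Fcd.
have [z [_ Fz]] := cK ((F : nat -> P) @ \oo) _ FK.
pose U k := [set y : P | forall j : 'I_k, `|z j - y j| < k.+1%:R^-1].
have zU k : nbhs z (U k).
  apply: (@filter_forall P 'I_k (fun j => [set y | `|z j - y j| < k.+1%:R^-1])
    (nbhs z) (nbhs_filter z)) => j.
  have k0 : (0 : R) < k.+1%:R^-1 by rewrite invr_gt0.
  have := @proj_continuous nat (fun=> R : topologicalType) j z.
  by move=> /(_ (ball (z j) k.+1%:R^-1)); apply; exact: (nbhsx_ballx (z j : R) _ k0).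
have {Fz}/choice[nu nuP] : forall p : nat * nat, exists n, (p.1 <= n)%N /\ U p.2 (F n).
  move=> [N k] /=; have [|y [[n Nn <-] Un]] := Fz (F @` [set n | (N <= n)%N]) _ _ (zU k).
    by exists N => // n Nn; exists n.
  by exists n.
(* [nu (N, k)] is an index from [N] on whose row lies in [U k]; starting just after the previous
   index makes [phi] strictly increasing. *)
pose phi := fix phi k := if k is k'.+1 then nu ((phi k').+1, k) else nu (0%N, 0%N).
have phiU k : U k (F (phi k)).
  by case: k => [|k]; [exact: (nuP (0, 0)%N).2|exact: (nuP ((phi k).+1, k.+1)).2].
exists phi; first by apply/increasing_seqP => k; exact: (nuP ((phi k).+1, k.+1)).1.
move=> m; apply/cvg_ex; exists (z m); apply/cvgrPdist_lt => e e0.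
near=> k; have mk : (m < k)%N by near: k; exact: nbhs_infty_gt.
apply: lt_trans (phiU k (Ordinal mk)) _; near: k.
exact: near_infty_natSinv_lt (PosNum e0).
Unshelve. all: by end_near. Qed.

Lemma countable_subsequence (R : realType) (c d : R) (T : Type) (E : set T)
    (F : nat -> T -> R) :
  (forall n x, c <= F n x <= d) -> countable E ->
  exists2 phi : nat -> nat, increasing_seq phi &
    forall x, E x -> cvgn (fun n => F (phi n) x).
Proof.
move=> Fcd /countable_injP[h hE].
have [[x0 Ex0]|nE] := pselect (exists x, E x); last first.
  by exists id => // x Ex; exfalso; apply: nE; exists x.
have /choice[k kP] m : exists x, forall y, E y -> h y = m -> x = y.
  have [[x [Ex xm]]|nx] := pselect (exists x, E x /\ h x = m).
    by exists x => y Ey ym; apply: hE; [exact: mem_set|exact: mem_set|rewrite xm ym].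
  by exists x0 => y Ey ym; exfalso; apply: nx; exists y.
have [phi iphi cphi] := diagonal_subsequence (fun n m => Fcd n (k m)).
exists phi => // x Ex; have -> : x = k (h x) by rewrite (kP _ x).
exact: cphi.
Qed.

(** Terms within 1/2 of the limit differ by less than 1, so values 0 and 1 can no longer alternate.
    Convergence of indicators thus decides countably many statements along one subsequence. *)
Lemma cvg_indicator (R : realType) (P : nat -> Prop) :
  cvgn (fun n => (`[< P n >])%:R : R) ->
  (\forall n \near \oo, P n) \/ (\forall n \near \oo, ~ P n).
Proof.
move=> /cvg_ex[l /cvgrPdist_lt/(_ 2^-1)[]]; first by rewrite invr_gt0.
move=> N _ Nl.
have NN : `|l - (`[< P N >])%:R| < 2^-1 :> R by exact: (Nl N (leqnn N)).
have key n : (N <= n)%N -> `[< P n >] = `[< P N >].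
  move=> /Nl/= nl; have : `|(`[< P n >])%:R - (`[< P N >])%:R| < (1 : R).
    rewrite (le_lt_trans (ler_distD l _ _))// [ltRHS]splitr !mul1r ltrD//.
    by rewrite distrC.
  by case: asboolP => _; case: asboolP => _ //=;
    rewrite ?mulr0n ?mulr1n ?subr0 ?sub0r ?normrN normr1 ltxx.
have [PN|nPN] := asboolP (P N); [left|right]; exists N => // n /key e.
  by apply/asboolP; rewrite e asboolT.
by apply/asboolPn; rewrite e; apply/asboolPn.
Qed.

(** * Convex neighbourhoods in the shadow topology *)

Lemma nbhs_branches (X : choiceType) (B : X -> X -> X -> Prop) (A : set X) (x : X) :
  branches B A -> A x -> nbhs (x : shadow B) A.
Proof.
move=> BA Ax; apply: (@open_nbhs_nbhs (shadow B)); split=> //.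
exists [set A]; last by rewrite bigcup_set1.
move=> _ ->; exists [fset A]%fset; first by move=> C /fset1P ->; exact: mem_set.
by apply/seteqP; split=> [y /(_ A (fset11 A))|y Ay C /fset1P ->].
Qed.

Lemma convex_separation (X : choiceType) (B : X -> X -> X -> Prop) (k : nat)
    (p : 'I_k -> X) : median_pretree B -> injective p ->
  exists W : 'I_k -> set X, [/\ forall i, tree_convex B (W i),
    forall i j, i != j -> W i `&` W j = set0 &
    forall i, nbhs (p i : shadow B) (W i)].
Proof.
move=> mB pinj; have pB := median_is_pretree mB.
have /choice[S SP] q : exists S : set X * set X, q.1 <> q.2 ->
    [/\ branches B S.1, branches B S.2, S.1 q.1, S.2 q.2 & S.1 `&` S.2 = set0].
  have [e|/eqP ne] := eqVneq q.1 q.2; first by exists (set0, set0).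
  by have [S SP] := branch_separation mB ne; exists S.
have convS A : branches B A -> tree_convex B A.
  by move=> [u [v [_ ->]]]; exact: convex_branch.
(* The pairs [S (x, y)] and [S (y, x)] are chosen independently. Intersecting their members around
   [x] makes the definition symmetric, so that [O x y] and [O y x] are disjoint. *)
pose O x y := (S (x, y)).1 `&` (S (y, x)).2.
have neq i j : j != i -> p i <> p j by move=> /eqP ji /pinj ij; exact: ji.
exists (fun i => [set z | forall j, j != i -> O (p i) (p j) z]); split.
- move=> i x y Wx Wy z xyz j ji; have ij := neq _ _ ji.
  have [Bij _ _ _ _] := SP (p i, p j) ij.
  have [_ Bji _ _ _] := SP (p j, p i) (nesym ij).
  exact: (tree_convexI (convS _ Bij) (convS _ Bji) (Wx j ji) (Wy j ji) xyz).
- move=> i j ij; apply/seteqP; split=> // z [Wi Wj].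
  have ji : j != i by rewrite eq_sym.
  have [_ _ _ _ <-] := SP (p i, p j) (neq _ _ ji).
  by split; [exact: (Wi j ji).1|exact: (Wj i ij).2].
- move=> i; apply: (@filter_forall (shadow B) 'I_k
    (fun j => [set z | j != i -> O (p i) (p j) z])
    (nbhs (p i : shadow B)) (nbhs_filter _)) => j.
  have [->|ji] := eqVneq j i; first exact: nearW.
  have ij := neq _ _ ji.
  have [Bij _ Sij _ _] := SP (p i, p j) ij.
  have [_ Bji _ Sji _] := SP (p j, p i) (nesym ij).
  apply: filterS (filterI (nbhs_branches Bij Sij) (nbhs_branches Bji Sji)).
  by move=> z Oz _.
Qed.

(** * Selection by oscillation over a countable network *)

Section Helly.
Variables (R : realType) (X : choiceType) (B : X -> X -> X -> Prop).
Hypothesis mB : median_pretree B.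
Variables (I : Type) (V : I -> set (shadow B)).
Hypothesis nV : network V.
Variables (r : R) (f : nat -> X -> R).
Hypothesis fr : forall n, (tree_variation B (f n) <= r%:E)%E.

Definition small_osc (n : nat) (i : I) (k : nat) : Prop :=
  forall a b, V i a -> V i b -> `|f n a - f n b| <= k.+1%:R^-1.

Definition osc_points (k : nat) : set X := [set x | forall i, V i x ->
  ~ \forall n \near \oo, small_osc n i k].

Lemma finite_osc_points (k : nat) :
  (forall i, (\forall n \near \oo, small_osc n i k) \/
             (\forall n \near \oo, ~ small_osc n i k)) ->
  finite_set (osc_points k).
Proof.
move=> dich; apply: contrapT => inf.
(* [N] is large enough that [N / (k + 1)] exceeds [r]. *)
pose N := (Num.trunc (r * k.+1%:R)).+1.
have rN : r * k.+1%:R < N%:R by exact: truncnS_gt.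
have [F FA NF] := infinite_set_fset N inf.
pose p (i : 'I_N) : X := tnth (in_tuple F) (widen_ord NF i).
have pinj : injective p.
  have /tuple_uniqP injF : uniq (in_tuple F) by exact: fset_uniq.
  by move=> i j /injF/(congr1 val)/= ij; exact: val_inj.
have pA i : osc_points k (p i) by apply: FA; exact: mem_tnth.
have [W [cW dW nW]] := convex_separation mB pinj.
have /choice[w wP] i : exists j, V j (p i) /\ V j `<=` W i.
  by have [j] := nV (nW i); exists j.
(* The dichotomy turns failure infinitely often into failure from some index on; hence all [N]
   neighbourhoods fail at one common [n], as a bound on the single function [f n] requires. *)
have : \forall n \near \oo, forall i, ~ small_osc n (w i) k.
  apply: filter_forall => i; have [Vi _] := wP i.
  by have [/(pA i _ Vi)|] := dich (w i).
move=> [n _ /(_ n (leqnn n)) nsmall].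
have /choice[q qP] i : exists q : X * X, [/\ W i q.1, W i q.2 &
    k.+1%:R^-1 < `|f n q.1 - f n q.2|].
  have [_ VW] := wP i.
  have /existsNP[a /existsNP[b /not_implyP[Va /not_implyP[Vb /negP]]]] := nsmall i.
  by rewrite -ltNge => ab; exists (a, b); split => //=; exact: VW.
have := sum_dist_le_variation (x := fun i => (q i).1) (y := fun i => (q i).2)
  mB (fr n) cW dW (fun i => let: And3 h _ _ := qP i in h)
  (fun i => let: And3 _ h _ := qP i in h).
apply/negP; rewrite -ltNge.
apply: (@lt_le_trans _ _ (\sum_(i < N) k.+1%:R^-1)).
  by rewrite sumr_const card_ord -[_ *+ N]mulr_natl ltr_pdivlMr.
by apply: ler_sum => i _; apply: ltW; have [] := qP i.
Qed.

End Helly.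

(** On a fixed finite subalgebra the variation is a finite sum depending continuously on finitely
    many values, so the bound passes to the limit there; the supremum is taken last. *)
Lemma cvg_tree_variation (R : realType) (X : choiceType)
    (B : X -> X -> X -> Prop) (f : nat -> X -> R) (g : X -> R) (r : R) :
  (forall n, (tree_variation B (f n) <= r%:E)%E) ->
  (forall x, f ^~ x @ \oo --> g x) -> (tree_variation B g <= r%:E)%E.
Proof.
move=> fr fg; apply/tree_variationP => s fs ss.
pose A := fset_set (adj B s).
have sE h : tree_variation_on B h s = \sum_(D <- A | D \in A) jump h D :> R.
  by rewrite tree_variation_onE// big_seq.
have cvgs : (fun n => tree_variation_on B (f n) s) @ \oo --> tree_variation_on B g s.
  rewrite sE (_ : (fun n => _) = fun n => \sum_(D <- A | D \in A) jump (f n) D).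
    apply: (@cvg_big R _ +%R 0) => [|D]; first exact: add_continuous.
    rewrite in_fset_set; last exact: finite_adj.
    move=> /set_mem[a [b [_ _ _ _ ->]]].
    rewrite jumpE (_ : (fun n => _) = fun n => `|f n a - f n b|).
      by apply: cvg_norm; exact: cvgB.
    by apply/funext => n; rewrite jumpE.
  by apply/funext => n; exact: sE.
apply: (cvgr_to_le cvgs); apply: nearW => n.
by move/tree_variationP : (fr n); exact.
Qed.

Theorem theoremB (R : realType) (X : choiceType) (B : X -> X -> X -> Prop)
    (mX : median_pretree B) (pX : polish R (shadow B))
    (c d r : R) (cd : c <= d) (r0 : 0 < r)
    (f : nat -> X -> R) (fcd : forall n x, c <= f n x <= d)
    (fr : forall n, (tree_variation B (f n) <= r%:E)%E) :
  exists phi : nat -> nat, increasing_seq phi /\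
    exists g : X -> R,
      [/\ forall x, c <= g x <= d,
          forall x, (fun k => f (phi k) x) @ \oo --> g x
        & (tree_variation B g <= r%:E)%E].
Proof.
have [M [sM _ hM]] := pX.
have [V0 nV0] := separable_network sM.
have [V nV] := homeomorphic_network hM nV0.
(* A point [x0] is needed as a default below; on empty [X] any function is a limit. *)
have [[x0 _]|noX] := pselect (exists x : X, True); last first.
  exists id; split=> //; exists (f 0%N); split => // x.
  by exfalso; apply: noX; exists x.
pose osc n (t : nat * nat * nat) : R := (`[< small_osc V f n t.1 t.2 >])%:R.
have osc01 n t : 0 <= osc n t <= 1 by rewrite ler0n lern1 leq_b1.
have [phi iphi cphi] := countable_subsequence osc01 (countableP setT).
have dich k i := cvg_indicator (cphi (i, k) I).
have finE k : finite_set (osc_points V (f \o phi) k).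
  exact: (finite_osc_points mX nV (fun n => fr (phi n)) (dich k)).
(* The exceptional points for every [k], and one sample point of each [V i], with default [x0] when
   [V i] is empty. *)
pose E := \bigcup_(t : nat + nat * nat) match t with
  | inl k => osc_points V (f \o phi) k
  | inr i => [set xget x0 (V i)]
  end.
have cE : countable E.
  apply: bigcup_countable => // -[k|i] _; apply: finite_set_countable.
    exact: finE.
  exact: finite_set1.
have [psi ipsi cpsi] := countable_subsequence (fun n => fcd (phi n)) cE.
have cvgf x : cvgn (fun n => f (phi (psi n)) x).
  have [Ex|nEx] := pselect (E x); first exact: cpsi.
  apply/cauchy_cvgP; apply: cauchy_exP => e e0.
  have e20 : 0 < e / 2 by rewrite divr_gt0.
  have [k _ /(_ k (leqnn k))/= ke] := near_infty_natSinv_lt (PosNum e20).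
  have [i Vix [N _ oscN]] : exists2 i, V i x &
      \forall n \near \oo, small_osc V (f \o phi) n i k.
    apply: contrapT => h; apply: nEx; exists (inl k) => // i Vi osci.
    by apply: h; exists i.
  pose y := xget x0 (V i).
  have Viy : V i y by apply: xgetPex; exists x.
  have /cvg_ex[l /cvgrPdist_lt/(_ _ e20) yl] : cvgn (fun n => f (phi (psi n)) y).
    by apply: cpsi; exists (inr i).
  (* The oscillation bound, valid from [N] on along [phi], persists along [phi \o psi]. *)
  have psiN n : (n <= psi n)%N.
    elim: n => // n IH; apply: leq_ltn_trans IH _.
    by have/increasing_seqP := ipsi; exact.
  (* The limit [l] at the sample point [y] serves as centre: half of [e] comes from convergence at
     [y], half from the oscillation on [V i], which contains [x] and [y]. *)
  exists l; near=> n.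
  rewrite /ball/= (splitr e) (le_lt_trans (ler_distD (f (phi (psi n)) y) _ _))//.
  rewrite ltrD//; first by near: n.
  apply: le_lt_trans ke; apply: oscN => //.
  by apply: leq_trans (psiN n); near: n; exact: nbhs_infty_ge.
exists (phi \o psi); split; first by move=> m n; rewrite /= iphi; exact: ipsi.
exists (fun x => limn (fun k => f (phi (psi k)) x)); split => [x|x|].
- apply/andP; split.
    apply: limr_ge; first exact: cvgf.
    by apply: nearW => n; have /andP[] := fcd (phi (psi n)) x.
  apply: limr_le; first exact: cvgf.
  by apply: nearW => n; have /andP[] := fcd (phi (psi n)) x.
- exact: cvgf.
- by apply: (cvg_tree_variation (f := f \o (phi \o psi))) => // n; exact: fr.
Unshelve. all: by end_near. Qed.
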